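(* Let $n \ge 1$ be an integer and let $\mu = r(\cos\alpha + i\sin\alpha) \in \mathbb{C}$, with $r > 0$ and $\alpha \in (-\pi,\pi]$. Suppose that $|\alpha| \ge \pi/n$. Then there is a polynomial $q$ of degree $n$ with nonnegative (real) coefficients such that $q(0) \ne 0$ and $q(\mu) = 0$. Furthermore, if in addition $n > 1$ and $\frac{\pi}{\alpha} \notin \mathbb{Z}$, then there is a polynomial $q$ of degree $n$ with positive coefficients such that $q(\mu) = 0$.
   Context: A polynomial $q(t) = \sum_{k=0}^n a_k t^k$ of degree $n$ (so $a_n \neq 0$) has nonnegative (respectively, positive) coefficients if $a_k$ is real with $a_k \ge 0$ (respectively, $a_k > 0$) for every $k = 0, 1, \ldots, n$. *)

(* Defs.v *)
From HB Require Import structures.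
From mathcomp Require Import all_boot all_order all_algebra.
From mathcomp Require Import reals trigo.
From mathcomp Require Import complex.

Set Implicit Arguments.
Unset Strict Implicit.
Unset Printing Implicit Defensive.

Import Order.TTheory GRing.Theory Num.Theory.
Local Open Scope ring_scope.

(* [size q = n.+1] says that q has degree exactly n, so the indices k < size q
   used below are k = 0, ..., n. *)
Definition has_degree (R : nzRingType) (n : nat) (q : {poly R}) : Prop :=
  size q = n.+1.

Definition nonneg_coefs (R : numDomainType) (q : {poly R}) : Prop :=
  forall k : nat, (k < size q)%N -> 0 <= q`_k.

Definition pos_coefs (R : numDomainType) (q : {poly R}) : Prop :=
  forall k : nat, (k < size q)%N -> 0 < q`_k.

Definition ceval (R : rcfType) (q : {poly R}) (z : R[i]) : R[i] :=
  (map_poly (real_complex R) q).[z].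

(* Main.v *)
(* Write a = |alpha| and let m be minimal with m a >= pi, so that m <= n and
   m a < 2 pi when m > 1.  For 0 < k < m the numbers 1, e^(i k a), e^(i m a)
   satisfy the linear relation
     sin ((m - k) a) - sin (m a) e^(i k a) + sin (k a) e^(i m a) = 0,
   whose coefficients are nonnegative by the choice of m.  One such relation,
   rescaled by powers of r, is a polynomial of degree m with nonnegative
   coefficients; the sum over all k has positive coefficients when m a > pi.
   Multiplication by 1 + X raises the degree from m to n.  When m = 1, mu is
   the negative number - r and X + r replaces these trinomials. *)
Require Import Defs.
From HB Require Import structures.
From mathcomp Require Import all_boot all_order all_algebra.
From mathcomp Require Import reals trigo.
From mathcomp Require Import complex.
From mathcomp Require Import ring lra zify.

Set Implicit Arguments.
Unset Strict Implicit.
Unset Printing Implicit Defensive.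

Import Order.TTheory GRing.Theory Num.Theory.
Local Open Scope ring_scope.
Local Open Scope complex_scope.

(** * Raising the degree with the factor 1 + X *)

Section PolynomialFactors.
Variable R : rcfType.
Implicit Types (p q : {poly R}) (z : R[i]) (n k : nat).

Lemma cevalM p q z : ceval (p * q) z = ceval p z * ceval q z.
Proof. by rewrite /ceval rmorphM hornerM. Qed.

Lemma ceval0 p : ceval p 0 = (p`_0)%:C.
Proof. by rewrite /ceval horner_coef0 coef_map. Qed.

Lemma has_degree_coef n q :
  (size q <= n.+1)%N -> q`_n != 0 -> has_degree n q.
Proof.
move=> sq qn0; apply/eqP; rewrite eqn_leq sq ltnNge.
by apply: contra qn0 => /(nth_default 0)->.
Qed.

Lemma has_degree_mul1DX n q : has_degree n q -> has_degree n.+1 (q * (1 + 'X)).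
Proof.
rewrite /has_degree addrC -polyC1 => sq.
by rewrite size_Mmonic ?monicXaddC ?size_XaddC -?size_poly_gt0 ?sq // addn2.
Qed.

Lemma coef_mul1DX q k :
  (q * (1 + 'X))`_k = q`_k + (if k is k'.+1 then q`_k' else 0).
Proof. by rewrite mulrDr mulr1 coefD coefMX; case: k. Qed.

Lemma nonneg_coefsP q : nonneg_coefs q <-> forall k, 0 <= q`_k.
Proof.
split=> q_ge0 k //; case: (ltnP k (size q)) => [/q_ge0 //|].
by move/(nth_default 0)->.
Qed.

Lemma nonneg_root_raise_degree n d z :
  (exists q, [/\ has_degree n q, nonneg_coefs q, ceval q 0 != 0
               & ceval q z = 0]) ->
  exists q, [/\ has_degree (n + d) q, nonneg_coefs q, ceval q 0 != 0
              & ceval q z = 0].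
Proof.
elim: d => [|d IHd]; first by rewrite addn0.
move=> /IHd[q [sq /nonneg_coefsP q_ge0 q0 qz]]; rewrite addnS.
exists (q * (1 + 'X)); split; first exact: has_degree_mul1DX.
- apply/nonneg_coefsP => -[|k]; rewrite coef_mul1DX ?addr0 //.
  exact: addr_ge0.
- by rewrite ceval0 coef_mul1DX addr0 -ceval0.
- by rewrite cevalM qz mul0r.
Qed.

Lemma pos_root_raise_degree n d z :
  (exists q, [/\ has_degree n q, pos_coefs q & ceval q z = 0]) ->
  exists q, [/\ has_degree (n + d) q, pos_coefs q & ceval q z = 0].
Proof.
elim: d => [|d IHd]; first by rewrite addn0.
move=> /IHd[q [sq q_gt0 qz]]; rewrite addnS.
have sq' := has_degree_mul1DX sq.
exists (q * (1 + 'X)); split=> //; last by rewrite cevalM qz mul0r.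
have q_ge0 : forall k, 0 <= q`_k.
  by apply/nonneg_coefsP => k /q_gt0/ltW.
move=> [|k]; rewrite coef_mul1DX sq' ?addr0 ?ltnS => k_le.
  by apply: q_gt0; rewrite sq.
(* Strictness comes from [q]_k[: at the top index]q[_k.+1] is 0. *)
by apply: ltr_wpDl => //; apply: q_gt0; rewrite sq ltnS.
Qed.

End PolynomialFactors.

(** * Trinomials vanishing at a point given in polar form *)

Section Trinomials.
Variable R : realType.
Implicit Types (r x : R) (m k : nat).

Lemma polar_expn r x k :
  (r%:C * (cos x +i* sin x)) ^+ k
    = (r ^+ k)%:C * (cos (k%:R * x) +i* sin (k%:R * x)).
Proof.
rewrite exprMn -rmorphXn; congr (_ * _).
elim: k => [|k IHk]; first by rewrite mul0r cos0 sin0.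
rewrite exprS IHk -natr1 mulrDl mul1r cosD sinD.
by apply/eqP; rewrite eq_complex /=; apply/andP; split; apply/eqP; ring.
Qed.

(** The powers of r give all three terms the same modulus factor r^m at a point of modulus r, so the
    relation on the unit circle carries over. *)
Definition trinomial r x m k : {poly R} :=
  (sin ((m - k)%:R * x) * r ^+ m)%:P - (sin (m%:R * x) * r ^+ (m - k)) *: 'X^k
    + sin (k%:R * x) *: 'X^m.

(** All coefficients are odd in x, so the trinomial built from |x| still vanishes at the point of
    angle x. *)
Lemma trinomialN r x m k : trinomial r (- x) m k = - trinomial r x m k.
Proof.
rewrite /trinomial !mulrN !sinN !mulNr !scaleNr polyCN opprK.
by rewrite !opprD opprK.
Qed.

(* Real and imaginary parts reduce to the addition formulas for
   [m x = (m - k) x + k x]. *)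
Lemma ceval_trinomial r x m k : (k <= m)%N ->
  ceval (trinomial r x m k) (r%:C * (cos x +i* sin x)) = 0.
Proof.
move=> k_le_m; rewrite /ceval /trinomial.
rewrite rmorphD rmorphB /= !map_polyZ map_polyC !map_polyXn !hornerE /=.
rewrite !polar_expn.
have -> : m%:R * x = (m - k)%:R * x + k%:R * x.
  by rewrite -mulrDl -natrD subnK.
have -> : r ^+ m = r ^+ (m - k) * r ^+ k by rewrite -exprD subnK.
rewrite sinD cosD.
have := cos2Dsin2 (k%:R * x).
move: (cos _) (sin _) (cos ((m - k)%:R * x)) (sin ((m - k)%:R * x)).
move=> c s c' s' cs1.
apply/eqP; rewrite eq_complex /=; apply/andP; split; apply/eqP; last by ring.
(* In the real part the terms in c' cancel; what remains vanishes by the Pythagorean identity. *)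
transitivity (s' * (r ^+ (m - k) * r ^+ k) * (1 - (c ^+ 2 + s ^+ 2))).
  by ring.
by rewrite cs1 subrr mulr0.
Qed.

Lemma ceval_trinomial_norm r x m k : (k <= m)%N ->
  ceval (trinomial r `|x| m k) (r%:C * (cos x +i* sin x)) = 0.
Proof.
move=> k_le_m; case: (leP 0 x) => [/ger0_norm->|/ltr0_norm->].
  exact: ceval_trinomial.
rewrite trinomialN /ceval rmorphN hornerN.
by have := ceval_trinomial r x k_le_m; rewrite /ceval => ->; rewrite oppr0.
Qed.

Lemma size_trinomial r x m k : (k <= m)%N ->
  (size (trinomial r x m k) <= m.+1)%N.
Proof.
move=> k_le_m; rewrite /trinomial.
apply: (leq_trans (size_polyD _ _)); rewrite geq_max; apply/andP; split.
  apply: (leq_trans (size_polyD _ _)); rewrite geq_max size_polyN.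
  rewrite (leq_trans (size_polyC_leq1 _)) //=.
  by apply: (leq_trans (size_scale_leq _ _)); rewrite size_polyXn.
by apply: (leq_trans (size_scale_leq _ _)); rewrite size_polyXn.
Qed.

Lemma coef_trinomial r x m k j :
  (trinomial r x m k)`_j
  = sin ((m - k)%:R * x) * r ^+ m *+ (j == 0)%N
    - sin (m%:R * x) * r ^+ (m - k) *+ (j == k)
    + sin (k%:R * x) *+ (j == m).
Proof.
rewrite /trinomial coefD coefB coefC !coefZ !coefXn.
by rewrite !mulr_natr; case: (j == 0%N).
Qed.

End Trinomials.

(** * Coefficient signs when m x is the first multiple of x to reach pi *)

Section FirstCrossing.
Variables (R : realType) (r x : R) (m : nat).
Hypotheses (r_gt0 : 0 < r) (x_gt0 : 0 < x) (m_gt1 : (1 < m)%N).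
Hypotheses (below : m.-1%:R * x < pi) (above : pi <= m%:R * x).

Let sin_multiple_gt0 k : (0 < k < m)%N -> 0 < sin (k%:R * x).
Proof.
case/andP=> k_gt0 k_lt_m; apply: sin_gt0_pi; rewrite mulr_gt0 ?ltr0n //.
apply: le_lt_trans below; rewrite ler_pM2r // ler_nat.
by rewrite -ltnS prednK // ltnW.
Qed.

(** As m - 1 >= 1, [below] also bounds x itself by pi. *)
Let crossing_lt2pi : m%:R * x < pi *+ 2.
Proof.
have -> : m%:R * x = m.-1%:R * x + x.
  by rewrite -[in LHS](ltn_predK m_gt1) -natr1 mulrDl mul1r.
have x_lt_pi : x < pi.
  apply: le_lt_trans below; rewrite -{1}[x]mul1r ler_pM2r // ler1n.
  by rewrite -ltnS (ltn_predK m_gt1).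
by rewrite mulr2n ltrD.
Qed.

Let sin_crossing : sin (m%:R * x) = - sin (m%:R * x - pi).
Proof. by rewrite -{1}(subrK pi (m%:R * x)) sinDpi. Qed.

Let sin_crossing_le0 : sin (m%:R * x) <= 0.
Proof.
rewrite sin_crossing oppr_le0 sin_ge0_pi // subr_ge0 above lerBlDr -mulr2n.
exact: ltW.
Qed.

Let sin_crossing_lt0 : pi < m%:R * x -> sin (m%:R * x) < 0.
Proof.
move=> lt_pi; rewrite sin_crossing oppr_lt0 sin_gt0_pi // subr_gt0 lt_pi.
by rewrite ltrBlDr -mulr2n.
Qed.

(** Both k x and (m - k) x lie in (0, pi), while m x lies in [pi, 2 pi), where the sine is
    nonpositive. *)
Lemma coef_trinomial_ge0 k j : (0 < k < m)%N -> 0 <= (trinomial r x m k)`_j.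
Proof.
move=> k_bd; rewrite coef_trinomial -mulNrn -mulNr.
have k'_bd : (0 < m - k < m)%N by lia.
rewrite !addr_ge0 ?mulrn_wge0 ?mulr_ge0 ?exprn_ge0 ?oppr_ge0 //;
  by apply: ltW => //; apply: sin_multiple_gt0.
Qed.

Lemma coef_trinomial_gt0_ends k j : (0 < k < m)%N -> (j == 0)%N || (j == m) ->
  0 < (trinomial r x m k)`_j.
Proof.
move=> k_bd; rewrite coef_trinomial.
have [k_neq0 k_neqm] : (0 == k)%N = false /\ (m == k) = false by lia.
have m_neq0 : (m == 0)%N = false by lia.
have k'_bd : (0 < m - k < m)%N by lia.
case/orP=> /eqP->; rewrite ?k_neq0 ?k_neqm ?eqxx ?m_neq0 ?(eq_sym 0%N m).
  by rewrite m_neq0 !mulr0n subr0 addr0 mulr1n mulr_gt0 ?exprn_gt0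
    ?sin_multiple_gt0.
by rewrite !mulr0n subr0 add0r mulr1n sin_multiple_gt0.
Qed.

Lemma coef_trinomial_gt0_middle k : pi < m%:R * x -> (0 < k < m)%N ->
  0 < (trinomial r x m k)`_k.
Proof.
move=> lt_pi k_bd; rewrite coef_trinomial eqxx.
have [-> ->] : (k == 0)%N = false /\ (k == m) = false by lia.
by rewrite !mulr0n sub0r addr0 mulr1n -mulNr mulr_gt0 ?exprn_gt0 //
  oppr_gt0 sin_crossing_lt0.
Qed.

End FirstCrossing.

(** * Polynomials of degree m with the prescribed root *)

Section FirstCrossingRoots.
Variables (R : realType) (r x : R) (m : nat).
Hypotheses (r_gt0 : 0 < r) (x_neq0 : x != 0) (m_gt1 : (1 < m)%N).
Hypothesis below : m.-1%:R * `|x| < pi.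

Let z : R[i] := r%:C * (cos x +i* sin x).

Let x_gt0 : 0 < `|x|. Proof. by rewrite normr_gt0. Qed.

Lemma nonneg_root_first_crossing : pi <= m%:R * `|x| ->
  exists q : {poly R},
    [/\ has_degree m q, nonneg_coefs q, ceval q 0 != 0 & ceval q z = 0].
Proof.
move=> above; exists (trinomial r `|x| m 1).
have ends j : (j == 0)%N || (j == m) -> 0 < (trinomial r `|x| m 1)`_j.
  exact: coef_trinomial_gt0_ends.
split.
- apply: has_degree_coef; first by rewrite size_trinomial // ltnW.
  by rewrite gt_eqF // ends // eqxx orbT.
- by apply/nonneg_coefsP => j; apply: coef_trinomial_ge0.
- by rewrite ceval0 fmorph_eq0 gt_eqF // ends.
- by rewrite ceval_trinomial_norm // ltnW.
Qed.

(* The middle coefficient of [trinomial r x m k] is [- sin (m x)] up to a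
   positive factor for every [k], so summing over [k] fills all the gaps. *)
Lemma pos_root_first_crossing : pi < m%:R * `|x| ->
  exists q : {poly R}, [/\ has_degree m q, pos_coefs q & ceval q z = 0].
Proof.
move=> above; have above_le := ltW above.
pose q := \sum_(k < m | (0 < k)%N) trinomial r `|x| m k.
have sq : (size q <= m.+1)%N.
  apply: (leq_trans (size_sum _ _ _)); apply/bigmax_leqP => k _.
  by rewrite size_trinomial // ltnW.
have q_gt0 j : (j <= m)%N -> 0 < q`_j.
  move=> j_le_m.
  have [k k_gt0 coef_gt0] : exists2 k : 'I_m, (0 < k)%N
      & 0 < (trinomial r `|x| m k)`_j.
    case: (boolP ((j == 0)%N || (j == m))) => [ends|mid].
      (* Every trinomial has positive end coefficients, so k = 1 serves; a middle index j is covered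
         by k = j. *)
      exists (Ordinal m_gt1) => //; exact: coef_trinomial_gt0_ends.
    have j_bd : (0 < j < m)%N by lia.
    have [j_gt0 j_lt] := andP j_bd; exists (Ordinal j_lt) => //.
    exact: coef_trinomial_gt0_middle.
  rewrite /q coef_sum (bigD1 k) //=; apply: ltr_wpDr => //.
  apply: sumr_ge0 => i /andP[i_gt0 _].
  by apply: coef_trinomial_ge0 => //; rewrite i_gt0 /=.
have degq : has_degree m q.
  by apply: has_degree_coef; rewrite ?gt_eqF ?q_gt0.
exists q; split=> //; first by move=> j; rewrite degq ltnS; exact: q_gt0.
rewrite /ceval rmorph_sum horner_sum big1 // => k _.
by apply: ceval_trinomial_norm; rewrite ltnW.
Qed.

End FirstCrossingRoots.

Theorem theorem1p4 (R : realType) (n : nat) (r alpha : R) (mu : R[i])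
    (hn : (1 <= n)%N)
    (hr : 0 < r)
    (halpha_gt : - pi < alpha) (halpha_le : alpha <= pi)
    (hmu : mu = r%:C * (cos alpha +i* sin alpha))
    (hangle : pi / n%:R <= `|alpha|) :
  (exists q : {poly R},
     [/\ has_degree n q, nonneg_coefs q, ceval q 0 != 0 & ceval q mu = 0])
  /\
  ((1 < n)%N -> pi / alpha \isn't a Num.int ->
   exists q : {poly R},
     [/\ has_degree n q, pos_coefs q & ceval q mu = 0]).
Proof.
have pi0 : 0 < pi :> R := pi_gt0 R.
have n_reaches : pi <= n%:R * `|alpha|.
  by rewrite mulrC -ler_pdivrMr // ltr0n.
have ex_m : exists m : nat, pi <= m%:R * `|alpha| by exists n.
have [m above m_min] := ex_minnP ex_m.
have m_le_n : (m <= n)%N := m_min n n_reaches.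
have alpha_neq0 : alpha != 0.
  apply: contraTneq n_reaches => ->.
  by rewrite normr0 mulr0 -ltNge.
have m_gt0 : (0 < m)%N.
  by case: (m) above => //; rewrite mul0r leNgt pi0.
have below : m.-1%:R * `|alpha| < pi.
  by rewrite ltNge; apply/negP => /m_min; lia.
rewrite hmu -(subnKC m_le_n).
case: (ltnP 1 m) => [m_gt1 | m_le1].
  split; first exact/nonneg_root_raise_degree/nonneg_root_first_crossing.
  move=> _ nint; apply/pos_root_raise_degree/pos_root_first_crossing => //.
  (* Equality pi = m |alpha| would make pi / alpha equal to m or - m. *)
  rewrite lt_neqAle above andbT; apply: contra nint => /eqP ->.
  case: (ger0P alpha) => _; rewrite ?mulrN ?mulNr mulfK //.
  rewrite rpredN; exact: natr_int.
have m1 : m = 1%N by lia.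
(* Here |alpha| >= pi, and - pi is excluded by [halpha_gt]. *)
have alphaE : alpha = pi.
  move: above; rewrite m1 mul1r ler_normr => /orP[|]; first by lra.
  by lra.
(* The second claim is vacuous: pi / alpha = 1 is an integer. *)
rewrite alphaE divff ?gt_eqF //; split; last by move=> _; rewrite rpred1.
apply: nonneg_root_raise_degree; rewrite m1 cospi sinpi.
exists ('X + r%:P); split.
- by rewrite /has_degree size_XaddC.
- apply/nonneg_coefsP => k; rewrite coefD coefX coefC.
  by apply: addr_ge0; [rewrite ler0n | case: ifP => // _; exact: ltW].
- by rewrite ceval0 fmorph_eq0 coefD coefX coefC /= add0r gt_eqF.
- rewrite /ceval rmorphD /= map_polyX map_polyC !hornerE /=.
  by apply/eqP; rewrite eq_complex /=; apply/andP; split; apply/eqP; ring.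
Qed.
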